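(* Let $\alpha=\{A_n:n\in\mathbb{N}\}$ be a partition of the unit interval (as described in the context) which is expansive of exponent $\theta\geq 0$ and eventually decreasing. For each $N\in\mathbb{N}$ let $$G_N^{(\alpha)}:=\{x=[\ell_1(x),\ell_2(x),\ldots]_\alpha\in[0,1]:\ \ell_i(x)>N\text{ for all }i\in\mathbb{N}\}.$$ Then $$\lim_{N\to\infty}\dim_H\left(G_N^{(\alpha)}\right)=\frac{1}{1+\theta}.$$
   Context: $\mathbb{N}=\{1,2,3,\ldots\}$, and $\dim_H$ denotes Hausdorff dimension. Partition: $\alpha=\{A_n:n\in\mathbb{N}\}$ is a countable partition of the unit interval consisting of right-closed, left-open intervals, ordered from right to left starting from $A_1$. Let $a_n>0$ be the Lebesgue measure of $A_n$ and $t_n:=\sum_{k=n}^\infty a_k$ (so $t_1=1$ and $A_n=(t_{n+1},t_n]$). $\alpha$-Lüroth map: $L_\alpha:[0,1]\to[0,1]$, $L_\alpha(x)=(t_n-x)/a_n$ for $x\in A_n$, $n\in\mathbb{N}$, and $L_\alpha(0)=0$. $\alpha$-Lüroth expansion: for $x\in[0,1]$, the finite or infinite sequence $(\ell_k)_{k\ge1}=(\ell_k(x))_{k\geq 1}$ of positive integers is determined by $L_\alpha^{k-1}(x)\in A_{\ell_k}$; it is finite if $L_\alpha^k(x)=0$ for some $k$. If it is infinite, write $x=[\ell_1,\ell_2,\ell_3,\ldots]_\alpha$; then $x=t_{\ell_1}+\sum_{n=2}^\infty(-1)^{n-1}\left(\prod_{i<n}a_{\ell_i}\right)t_{\ell_n}$.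 $\alpha$ is expansive of exponent $\theta\ge 0$ if $t_n=\psi(n)\,n^{-\theta}$ for all $n\in\mathbb{N}$, where $\psi:\mathbb{N}\to\mathbb{R}^+$ is slowly varying, i.e. the restriction to $\mathbb{N}$ of a measurable $f:\mathbb{R}^+\to\mathbb{R}^+$ with $\lim_{x\to\infty}f(xy)/f(x)=1$ for all $y>0$. $\alpha$ is eventually decreasing if $a_n<a_{n-1}$ for all sufficiently large $n\in\mathbb{N}$. *)

(* Defs.v *)
From mathcomp Require Import all_boot all_order all_algebra.
From mathcomp Require Import all_classical all_reals all_analysis.

Set Implicit Arguments.
Unset Strict Implicit.
Unset Printing Implicit Defensive.

Import Order.TTheory GRing.Theory Num.Theory.
Import numFieldNormedType.Exports.

Local Open Scope classical_set_scope.
Local Open Scope ring_scope.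

Section HausdorffDimension.
Context {R : realType}.
Implicit Types (U E : set R) (s delta : R).
Local Open Scope ereal_scope.

Definition diam U : \bar R :=
  ereal_sup [set `|x.1 - x.2|%:E | x in U `*` U].

(* The empty set contributes 0 for every s, so that the measure of index 0 is
   the counting measure although poweR gives 0 `^ 0 = 1. *)
Definition diam_pow s U : \bar R :=
  if U == set0 then 0 else diam U `^ s.

Definition hausdorff_premeasure s delta E : \bar R :=
  ereal_inf [set \sum_(i <oo) diam_pow s (U i) | U in
    [set U : nat -> set R |
       E `<=` \bigcup_i U i /\ forall i, diam (U i) <= delta%:E]].

Definition hausdorff_measure s E : \bar R :=
  ereal_sup [set hausdorff_premeasure s delta E | delta in
    [set delta : R | (0 < delta)%R]].

Definition hausdorff_dim E : \bar R :=
  ereal_inf [set s%:E | s in [set s : R | (0 <= s)%R /\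
    hausdorff_measure s E = 0]].

End HausdorffDimension.

(* Partition elements, digits and the sequences a and t are indexed by the
   positive integers; the value of such a family at index 0 is irrelevant. *)
Section AlphaLuroth.
Context {R : realType}.
Implicit Types (A : nat -> set R) (x theta : R).

(* The intervals being open on the left, it is `]0, 1] that they partition. *)
Definition luroth_partition A :=
  [/\ partition [set n | (0 < n)%N] A `]0, 1],
      forall n, (0 < n)%N -> exists u v : R, A n = `]u, v]%classic
    & forall m n x y, (0 < m < n)%N -> A m x -> A n y -> y < x].

Definition luroth_a A (n : nat) : R := fine (lebesgue_measure (A n)).

Definition luroth_t A (n : nat) : R :=
  fine (\sum_(n <= k <oo) (luroth_a A k)%:E)%E.

(* The index of the partition element containing x, and 0 if there is none,
   in particular for x = 0. *)
Definition luroth_digit A x : nat := xget 0%N [set n | (0 < n)%N /\ A n x].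

Definition luroth_map A x : R :=
  let n := luroth_digit A x in
  if n == 0%N then 0 else (luroth_t A n - x) / luroth_a A n.

(* l k is the (k+1)-st digit. As 0 lies in no partition element, x has an
   infinite expansion exactly when such an l exists, and l is then unique. *)
Definition infinite_luroth_expansion A x (l : nat -> nat) :=
  forall k, (0 < l k)%N /\ A (l k) (iter k (luroth_map A) x).

Definition luroth_G A (N : nat) : set R :=
  [set x | x \in `[0, 1] /\
    exists l, infinite_luroth_expansion A x l /\ forall k, (N < l k)%N].

(* R with the sigma-algebra of Lebesgue measurable sets, as opposed to the
   Borel sigma-algebra carried by R itself. *)
Definition lebesgueType :=
  caratheodory_type ((wlength (idfun : R -> R))^*)%mu.

Definition slowly_varying (psi : nat -> R) :=
  exists f : R -> R,
    [/\ measurable_fun (`]0, +oo[ : set lebesgueType) (f : lebesgueType -> R),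
        forall x, 0 < x -> 0 < f x,
        forall y, 0 < y -> f (x * y) / f x @[x --> +oo] --> (1 : R)
      & forall n, (0 < n)%N -> psi n = f n%:R].

Definition expansive A theta :=
  exists psi : nat -> R, slowly_varying psi /\
    forall n, (0 < n)%N -> luroth_t A n = psi n * n%:R `^ (- theta).

Definition eventually_decreasing A :=
  \forall n \near \oo, luroth_a A n < luroth_a A n.-1.

End AlphaLuroth.

(* Main.v *)
(* Write t_n = t n, a_n = t n - t n.+1. Along n = 2^k slow variation gives
   t_{2^(k+1)} / t_{2^k} -> 2^(-theta), and since a is eventually decreasing,
   a_n <= t_{2^k} / 2^k for n >= 2^(k+1). Hence sum a_n^s converges for
   s > 1/(1+theta). For s < 1/(1+theta) it diverges: a_n^s is at least
   a_n (t_{2^k}/2^k)^(s-1), so that the tail is at least of the order of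
   2^(k(1-s)) t_{2^k}^s, which is unbounded.
   Upper bound: once the tail q of sum a_n^s is < 1, the cylinders of length k
   cover G_N with s-sum at most q^k.
   Lower bound: take finitely many digits m <= n < M, m > N, with
   sum a_n^s >= 1. Points whose digits first differ after k steps are at
   distance comparable to the length of their common cylinder, so a cover of
   small s-sum yields countably many words whose weights prod a_n^s sum to less
   than 1. By the converse of Kraft's inequality some sequence of digits avoids
   all these words, and the corresponding point of G_N is not covered. *)
Require Import Defs.
From mathcomp Require Import all_boot all_order all_algebra.
From mathcomp Require Import all_classical all_reals all_analysis.
From mathcomp Require Import ring lra zify.
Set Implicit Arguments.
Unset Strict Implicit.
Unset Printing Implicit Defensive.
Import Order.TTheory GRing.Theory Num.Theory.
Import numFieldNormedType.Exports.
Local Open Scope classical_set_scope.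
Local Open Scope ring_scope.

(** * The partition elements as cells between consecutive tails [t] *)

Section Endpoints.
Context {R : realType}.
Variable A : nat -> set R.
Hypothesis partA : luroth_partition A.

Let endpoints (n : nat) : (0 < n)%N ->
  exists p : R * R, p.1 < p.2 /\ A n = `]p.1, p.2]%classic.
Proof.
move=> n0; case: partA => -[_ _ Ane] /(_ n n0)[u [v Auv]] _.
exists (u, v); split => //=.
have [x] := Ane n n0.
by rewrite Auv /= in_itv /= => /andP[ux xv]; exact: lt_le_trans xv.
Qed.

Let left n := xget (0, 0) [set p : R * R | p.1 < p.2 /\ A n = `]p.1, p.2]%classic].

Let leftP n : (0 < n)%N ->
  (left n).1 < (left n).2 /\ A n = `](left n).1, (left n).2]%classic.
Proof. by move=> n0; exact: xgetPex (endpoints n0). Qed.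

(** No point up to the right end of [A n] lies in an earlier cell, because earlier cells lie
    entirely to the right. *)
Let cup_tail n : (0 < n)%N ->
  \bigcup_(k in [set k | (n <= k)%N]) A k = `]0, (left n).2]%classic.
Proof.
move=> n0; have [lt_n An] := leftP n0.
have [[covA _ _] _ ordA] := partA.
have sub01 k x : (0 < k)%N -> A k x -> 0 < x.
  move=> k0 Akx; have : cover [set n | (0 < n)%N] A x by exists k.
  by rewrite covA /= in_itv /= => /andP[].
apply/seteqP; split => x /=.
  move=> [k /= nk Akx]; have k0 := leq_trans n0 nk.
  rewrite in_itv /= (sub01 _ _ k0 Akx) /=.
  move: nk; rewrite leq_eqVlt => /orP[/eqP nk|nk].
    by move: Akx; rewrite -nk An /= in_itv /= => /andP[].
  apply/ltW/(ordA n k) => //; first by rewrite n0.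
  by rewrite An /= in_itv /= lt_n lexx.
rewrite in_itv /= => /andP[x0 xn].
have Ann : A n (left n).2 by rewrite An /= in_itv /= lt_n lexx.
have : (cover [set n | (0 < n)%N] A) (left n).2 by exists n.
rewrite covA /= in_itv /= => /andP[_ n1].
have : (cover [set n | (0 < n)%N] A) x.
  by rewrite covA /= in_itv /= x0 (le_trans xn).
move=> [k k0 Akx]; exists k => //=; rewrite leqNgt; apply/negP => kn.
have := @ordA k n x (left n).2; rewrite k0 kn => /(_ isT Akx Ann).
by rewrite ltNge xn.
Qed.

Let measA n : (0 < n)%N -> measurable (A n).
Proof. by move=> /leftP[_ ->]; exact: measurable_itv. Qed.

Let aE n : (0 < n)%N -> lebesgue_measure (A n) = ((left n).2 - (left n).1)%:E.
Proof. by move=> /leftP[lt ->]; rewrite lebesgue_measure_itv /= lte_fin lt. Qed.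

(** A negative left end would put the nonpositive point [Num.min 0 (left n).2] in [A n], outside ]0,
    1]. *)
Let left_ge0 n : (0 < n)%N -> 0 <= (left n).1 < (left n).2.
Proof.
move=> n0; have [lt_n An] := leftP n0; rewrite lt_n andbT leNgt.
apply/negP => l0.
pose x := Num.min 0 (left n).2.
have : A n x.
  by rewrite An /= in_itv /= lt_min l0 lt_n /= ge_min lexx orbT.
have [[covA _ _] _ _] := partA.
move=> Anx; have : cover [set n | (0 < n)%N] A x by exists n.
by rewrite covA /= in_itv /= lt_min ltxx.
Qed.

(** By countable additivity, the tail sum is the Lebesgue measure of the interval found in
    [cup_tail]. *)
Let tE n : (0 < n)%N -> luroth_t A n = (left n).2.
Proof.
move=> n0.
have [[covA trivA _] _ _] := partA.
have /andP[l0 lr] := left_ge0 n0.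
rewrite /luroth_t.
suff -> : (\sum_(n <= k <oo) (luroth_a A k)%:E)%E = (left n).2%:E by [].
have m0 : forall k, (n <= k)%N -> measurable (A k).
  by move=> k nk; apply: measA; exact: leq_trans nk.
transitivity (lebesgue_measure (\bigcup_(k in [set k | (n <= k)%N]) A k)).
  rewrite measure_bigcup //; last 1 first.
    by move=> i j /= ni nj; apply: trivA; exact: (leq_trans n0).
  rewrite (eseries_mkcond (fun k => lebesgue_measure (A k))).
  rewrite -nneseries_addn; last by move=> k; rewrite lee_fin fine_ge0.
  rewrite [in RHS](nneseries_split 0 n); last by move=> k _; case: ifP.
  rewrite big1_seq ?add0e ?add0n; last first.
    move=> k /=; rewrite mem_index_iota /= => kn.
    by case: ifP => //; rewrite in_setE /= => /leq_ltn_trans/(_ kn); rewrite ltnn.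
  rewrite -[in RHS]nneseries_addn; last by move=> k /=; case: ifP.
  apply: eq_eseriesr => k _.
  rewrite mem_set /=; last exact: leq_addl.
  have k0 : (0 < k + n)%N by lia.
  by rewrite /luroth_a aE.
rewrite cup_tail // lebesgue_measure_itv /= lte_fin (le_lt_trans l0 lr).
by rewrite oppr0 adde0.
Qed.

(** The ordering excludes an overlap of the two cells. With a gap, the left end of [A n] would be
    covered neither by [A n] nor by the later cells, which together fill []0, (left n).2]]. *)
Let leftS n : (0 < n)%N -> (left n).1 = (left n.+1).2.
Proof.
move=> n0.
have /andP[l0 lr] := left_ge0 n0.
have [_ An] := leftP n0.
have /andP[l0' lr'] := left_ge0 (isT : 0 < n.+1)%N.
have Un : `]0, (left n).2]%classic = A n `|` `]0, (left n.+1).2]%classic.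
  rewrite -!cup_tail //; apply/seteqP; split => x /=.
    move=> [k /= nk Akx]; have [kn|kn] := eqVneq k n.
      by left; rewrite -kn.
    by right; exists k => //=; lia.
  move=> [Anx|[k /= nk Akx]]; first by exists n => /=.
  by exists k => //=; lia.
have : ~ A n (left n.+1).2.
  have [_ _ ordA] := partA.
  have [lt2 An1] := leftP (isT : 0 < n.+1)%N.
  move=> Ann; have := @ordA n n.+1 (left n.+1).2 (left n.+1).2.
  rewrite ltnSn n0 ltxx => /(_ isT Ann); rewrite An1 /= in_itv /= lt2 lexx.
  by move=> /(_ isT).
have r2 : (left n.+1).2 <= (left n).2.
  have : `]0, (left n).2]%classic (left n.+1).2.
    by rewrite Un; right; rewrite /= in_itv /= lexx (le_lt_trans l0').
  by rewrite /= in_itv /= => /andP[].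
rewrite An /= in_itv /= r2 andbT => /negP; rewrite -leNgt => r1.
apply/eqP; rewrite eq_le r1 andbT leNgt; apply/negP => r3.
have : `]0, (left n).2]%classic (left n).1.
  by rewrite /= in_itv /= (ltW lr) (le_lt_trans l0' (lt_trans lr' r3)).
rewrite Un An => -[]; rewrite /= in_itv /=; first by rewrite ltxx.
by rewrite leNgt r3 andbF.
Qed.

Lemma luroth_cell n : (0 < n)%N ->
  A n = `]luroth_t A n.+1, luroth_t A n]%classic.
Proof.
by move=> n0; rewrite (leftP n0).2 !tE // leftS.
Qed.

Lemma luroth_aE n : (0 < n)%N -> luroth_a A n = luroth_t A n - luroth_t A n.+1.
Proof. by move=> n0; rewrite /luroth_a aE //= !tE // leftS. Qed.

Lemma luroth_t_decr n : (0 < n)%N -> luroth_t A n.+1 < luroth_t A n.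
Proof. by move=> n0; rewrite !tE // -leftS //; have /andP[] := left_ge0 n0. Qed.

Lemma luroth_t_gt0 n : (0 < n)%N -> 0 < luroth_t A n.
Proof.
by move=> n0; rewrite tE //; have /andP[l0] := left_ge0 n0; exact: le_lt_trans.
Qed.

Lemma luroth_t1 : luroth_t A 1 = 1.
Proof.
have [[covA _ _] _ _] := partA.
have : `]0, (left 1).2]%classic = `]0, 1]%classic :> set R.
  by rewrite -covA -cup_tail.
rewrite tE // => E; have t0 : 0 < (left 1).2 by rewrite -tE // luroth_t_gt0.
apply/eqP; rewrite eq_le; apply/andP; split.
  have : `]0, (left 1).2]%classic (left 1).2 by rewrite /= in_itv /= t0 lexx.
  by rewrite E /= in_itv /= => /andP[].
have : `]0, (1:R)]%classic 1 by rewrite /= in_itv /= ltr01 lexx.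
by rewrite -E /= in_itv /= => /andP[].
Qed.

(** The left end of the cell containing [Num.min x 1] is such a tail. *)
Lemma luroth_t_small (x : R) : 0 < x -> exists2 n, (0 < n)%N & luroth_t A n < x.
Proof.
move=> x0; have [[covA _ _] _ _] := partA.
have : cover [set n | (0 < n)%N] A (Num.min x 1).
  by rewrite covA /= in_itv /= lt_min x0 ltr01 /= ge_min lexx orbT.
move=> [n /= n0]; rewrite luroth_cell //= in_itv /= => /andP[+ _].
by rewrite lt_min => /andP[? _]; exists n.+1.
Qed.

End Endpoints.

(** * Dyadic estimates for the sums of a_n^s *)

Lemma powR_lt_exponent {R : realType} (b x y : R) : 1 < b ->
  (b `^ x < b `^ y) = (x < y).
Proof.
move=> b1; rewrite /powR gt_eqF ?(lt_trans ltr01) //.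
by rewrite ltr_expR ltr_pM2r ?ln_gt0.
Qed.

Lemma mulr_powRB1_gt0 {R : realType} (x s : R) : 0 < x -> x * x `^ (s - 1) = x `^ s.
Proof.
move=> x0; rewrite -{1}(powRr1 (ltW x0)) -powRD; last by rewrite (gt_eqF x0) implybT.
by rewrite addrC subrK.
Qed.

Section Growth.
Context {R : realType}.
Variables (t : nat -> R) (theta : R).
Let a n := t n - t n.+1.
Hypothesis t_gt0 : forall n, (0 < n)%N -> 0 < t n.
Hypothesis t_decr : forall n, (0 < n)%N -> t n.+1 < t n.
Hypothesis t_small : forall x : R, 0 < x -> exists2 n, (0 < n)%N & t n < x.
Hypothesis t_double : t (n * 2)%N / t n @[n --> \oo] --> (2 : R) `^ (- theta).
Hypothesis a_decr : \forall n \near \oo, a n < a n.-1.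

(** The comparison quantity for dyadic blocks: up to a factor 2, it bounds the sum of a_i^s over
    2^(k+1) <= i < 2^(k+2) once k is large. *)
Let w (s : R) k := 2 ^+ k * (t (2 ^ k) / 2 ^+ k) `^ s.

Let t_gt0_pow k : 0 < t (2 ^ k).
Proof. by rewrite t_gt0 // expn_gt0. Qed.

Let w_gt0 s k : 0 < w s k.
Proof. by rewrite mulr_gt0 ?powR_gt0 ?divr_gt0 ?exprn_gt0. Qed.

Lemma t_le m n : (0 < m)%N -> (m <= n)%N -> t n <= t m.
Proof.
move=> m0 /subnK <-; elim: (n - m)%N => [//|k IH]; apply: le_trans IH.
by rewrite addSn ltW // t_decr // addn_gt0 m0 orbT.
Qed.

Let a_gt0 n : (0 < n)%N -> 0 < a n.
Proof. by move=> n0; rewrite subr_gt0 t_decr. Qed.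

Let a_noninc : exists2 K, (0 < K)%N & forall i j, (K <= i)%N -> (i <= j)%N -> a j <= a i.
Proof.
case: a_decr => K _ KP; exists K.+1 => // i j Ki /subnK <-.
elim: (j - i)%N => [//|k IH]; apply: le_trans IH.
rewrite addSn ltW //; apply: KP => /=; lia.
Qed.

Let sum_a m n : (m <= n)%N -> \sum_(m <= i < n) a i = t m - t n.
Proof.
move=> mn; rewrite -opprB -telescope_sumr // -sumrN.
by apply: eq_bigr => i _; rewrite opprB.
Qed.

(** By monotonicity a_n is at most the mean of a over the block from 2^k to 2^(k+1), whose sum
    telescopes to at most t_{2^k}. *)
Let a_dyadic : exists K, forall k n, (K <= k)%N -> (2 ^ k.+1 <= n)%N ->
  a n <= t (2 ^ k) / 2 ^+ k.
Proof.
have [K K0 KP] := a_noninc; exists K => k n Kk kn.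
have Kk2 : (K <= 2 ^ k)%N by rewrite (leq_trans Kk) // ltnW // ltn_expl.
rewrite ler_pdivlMr ?exprn_gt0 //.
have k12 : (2 ^ k <= 2 ^ k.+1)%N by rewrite leq_exp2l.
apply: le_trans (_ : t (2 ^ k) - t (2 ^ k.+1) <= _); last first.
  by rewrite gerBl ltW.
rewrite -sum_a // -natrX mulr_natr.
have -> : (a n *+ 2 ^ k) = \sum_(2 ^ k <= i < 2 ^ k.+1) a n.
  by rewrite sumr_const_nat; congr (_ *+ _); rewrite expnS; lia.
apply: ler_sum_nat => i /andP[ki ik].
by apply: KP; [exact: leq_trans ki|exact: leq_trans (ltnW ik) kn].
Qed.

Let ratio_cvg : t (2 ^ k.+1) / t (2 ^ k) @[k --> \oo] --> (2 : R) `^ (- theta).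
Proof.
have pow_oo : (2 ^ k)%N @[k --> \oo] --> \oo.
  move=> P [N _ NP]; exists N => // k /= Nk; apply: NP => /=.
  by rewrite (leq_trans Nk) // ltnW // ltn_expl.
have := cvg_comp _ _ pow_oo t_double.
by apply: cvg_trans; apply: near_eq_cvg; near=> k; rewrite /= expnSr.
Unshelve. all: by end_near. Qed.

Let w_ratio s k :
  w s k.+1 = 2 * (t (2 ^ k.+1) / t (2 ^ k) / 2) `^ s * w s k.
Proof.
rewrite /w [2 ^+ k.+1]exprS.
have -> : t (2 ^ k.+1) / (2 * 2 ^+ k) =
    (t (2 ^ k.+1) / t (2 ^ k) / 2) * (t (2 ^ k) / 2 ^+ k).
  by rewrite invfM -[RHS]mulrA [2^-1 * (_ / _)]mulrCA !mulrA divfK // gt_eqF.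
rewrite powRM ?divr_ge0 ?exprn_ge0 // ?ltW //.
by ring.
Qed.

Let powR_half (s x : R) : 0 <= s ->
  2 * ((2 : R) `^ (- x) / 2) `^ s = 2 `^ (1 - s * (1 + x)).
Proof.
move=> s0.
rewrite -[X in _ / X]powRr1 // -powRB ?pnatr_eq0 ?implybT //.
rewrite -powRrM -[X in X * _]powRr1 // -powRD ?pnatr_eq0 ?implybT //.
by congr (_ `^ _); ring.
Qed.

(** The ratios of consecutive [w] tend to 2^(1 - s(1 + theta)) < 1; lowering theta slightly leaves
    room for a strict eventual bound. *)
Let w_upper s : 0 <= s -> 1 < s * (1 + theta) ->
  exists2 rho : R, 0 < rho < 1 &
    \forall k \near \oo, w s k.+1 <= rho * w s k.
Proof.
move=> s0 s1.
(* Chosen so that the perturbed exponent 1 - s(1 + theta - e) equals -e. *)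
pose e := (s * (1 + theta) - 1) / (1 + s).
have s1' : 0 < 1 + s by lra.
have e0 : 0 < e by rewrite divr_gt0 // subr_gt0.
have es : e * (1 + s) = s * (1 + theta) - 1 by rewrite divfK // gt_eqF.
exists (2 `^ (1 - s * (1 + (theta - e)))).
  rewrite powR_gt0 //= -[ltRHS](powRr0 2) powR_lt_exponent ?ltr1n //.
  nra.
near=> k.
rewrite w_ratio -powR_half // ler_wpM2r ?ler_wpM2l ?(ltW (w_gt0 _ _)) //.
have q0 : 0 <= t (2 ^ k.+1) / t (2 ^ k) by rewrite divr_ge0 ?ltW.
apply: ge0_ler_powR => //; [by rewrite nnegrE divr_ge0|by rewrite nnegrE divr_ge0 ?powR_ge0|].
rewrite ler_pM2r ?invr_gt0 //.
apply/ltW; near: k; apply: (cvgr_lt _ ratio_cvg).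
by rewrite powR_lt_exponent ?ltr1n //; lra.
Unshelve. all: by end_near. Qed.

Let w_lower s : 0 <= s -> s * (1 + theta) < 1 ->
  exists2 rho : R, 1 < rho &
    \forall k \near \oo, rho * w s k <= w s k.+1.
Proof.
move=> s0 s1.
(* Here the perturbed exponent 1 - s(1 + theta + e) equals e. *)
pose e := (1 - s * (1 + theta)) / (1 + s).
have s1' : 0 < 1 + s by lra.
have e0 : 0 < e by rewrite divr_gt0 // subr_gt0.
have es : e * (1 + s) = 1 - s * (1 + theta) by rewrite divfK // gt_eqF.
exists (2 `^ (1 - s * (1 + (theta + e)))).
  rewrite -[ltLHS](powRr0 2) powR_lt_exponent ?ltr1n //.
  nra.
near=> k.
rewrite w_ratio -powR_half // ler_wpM2r ?ler_wpM2l ?(ltW (w_gt0 _ _)) //.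
have q0 : 0 <= t (2 ^ k.+1) / t (2 ^ k) by rewrite divr_ge0 ?ltW.
apply: ge0_ler_powR => //; [by rewrite nnegrE divr_ge0|by rewrite nnegrE divr_ge0 ?powR_ge0|].
rewrite ler_pM2r ?invr_gt0 //.
apply/ltW; near: k; apply: (cvgr_gt _ ratio_cvg).
by rewrite powR_lt_exponent ?ltr1n //; lra.
Unshelve. all: by end_near. Qed.

Lemma sum_powR_tail_cvg0 s : 0 <= s -> 1 < s * (1 + theta) ->
  (\sum_(N <= k <oo) (a k `^ s)%:E)%E @[N --> \oo] --> (0%R%:E : \bar R).
Proof.
move=> s0 s1.
have [K KP] := a_dyadic.
have [rho /andP[rho0 rho1] [K' _ K'P]] := w_upper s0 s1.
pose k0 := maxn K K'.
have block k : (k0 <= k)%N ->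
    \sum_(2 ^ k.+1 <= i < 2 ^ k.+2) a i `^ s <= 2 * w s k.
  move=> k0k; have k12 : (2 ^ k.+1 <= 2 ^ k.+2)%N by rewrite leq_exp2l.
  have -> : 2 * w s k = \sum_(2 ^ k.+1 <= i < 2 ^ k.+2) (t (2 ^ k) / 2 ^+ k) `^ s.
    rewrite sumr_const_nat.
    have -> : (2 ^ k.+2 - 2 ^ k.+1 = 2 ^ k.+1)%N by rewrite !expnS; lia.
    by rewrite /w mulrA -exprS -natrX mulr_natl.
  apply: ler_sum_nat => i /andP[ki ik].
  apply: ge0_ler_powR => //.
  - by rewrite nnegrE ltW // a_gt0 // (leq_trans _ ki) // expn_gt0.
  - by rewrite nnegrE divr_ge0 // ?exprn_ge0 // ltW.
  - by apply: KP => //; rewrite (leq_trans _ k0k) // leq_maxl.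
(* [C] solves C rho + 2 = C: when a block is added to the partial sum, the drop of [C * w] pays for
   it, so the left side of [part] never increases with [j]. *)
pose C := 2 / (1 - rho).
have rho1' : 0 < 1 - rho by rewrite subr_gt0.
have C0 : 0 < C by rewrite divr_gt0.
have CE : C * rho + 2 = C by rewrite /C; field; rewrite gt_eqF.
have part j : \sum_(2 ^ k0.+1 <= i < 2 ^ (k0 + j).+1) a i `^ s + C * w s (k0 + j)%N
    <= C * w s k0.
  elim: j => [|j IH]; first by rewrite addn0 big_geq // add0r.
  have k12 : (2 ^ (k0 + j).+1 <= 2 ^ (k0 + j).+2)%N by rewrite leq_exp2l.
  have k01 : (2 ^ k0.+1 <= 2 ^ (k0 + j).+1)%N by rewrite leq_exp2l // ltnS leq_addr.
  rewrite addnS (big_cat_nat k01 k12) /=.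
  have B := block (k0 + j)%N (leq_addr _ _).
  have := K'P (k0 + j)%N; rewrite /= (leq_trans (leq_maxr K K') (leq_addr _ _)).
  move=> /(_ isT); rewrite -(ler_pM2l C0) => W.
  apply: le_trans IH; rewrite -addrA lerD2l.
  apply: le_trans (lerD B W) _.
  by move: (w s _) => x; rewrite -{2}CE; nra.
have fin : ((\sum_(0 <= k <oo) (a k `^ s)%:E)%E < +oo)%E.
  rewrite (nneseries_split 0 (2 ^ k0.+1)%N); last by move=> k _; rewrite lee_fin powR_ge0.
  rewrite add0n sumEFin lte_add_pinfty ?ltry //.
  apply: le_lt_trans (ltry (C * w s k0)).
  apply: lime_le.
    by apply: is_cvg_nneseries => k _ _; rewrite lee_fin powR_ge0.
  near=> n; rewrite sumEFin lee_fin.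
  have nk : (n <= 2 ^ (k0 + n).+1)%N.
    by rewrite (leq_trans (ltnW (ltn_expl n (isT : 1 < 2)%N))) // leq_exp2l //; lia.
  have kn : (2 ^ k0.+1 <= n)%N by near: n; exact: nbhs_infty_ge.
  apply: le_trans (part n).
  rewrite (big_cat_nat kn nk) /= -addrA lerDl addr_ge0 //.
    by rewrite sumr_ge0 // => i _; exact: powR_ge0.
  by rewrite mulr_ge0 ?ltW.
apply: (@nneseries_tail_cvg R (fun k => (a k `^ s)%:E) xpredT fin).
by move=> k _; rewrite lee_fin powR_ge0.
Unshelve. all: by end_near. Qed.

(** As s - 1 < 0, the upper bound b = t_{2^k} / 2^k on a_n gives a_n^s >= a_n b^(s-1), and the sum
    of the a_n telescopes. What remains is at least a constant times [w s k], which grows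
    geometrically. *)
Lemma sum_powR_large s m : 0 <= s -> 0 <= theta -> s * (1 + theta) < 1 -> (0 < m)%N ->
  exists M, 1 <= \sum_(m <= i < M) a i `^ s.
Proof.
move=> s0 th0 s1 m0.
have s1' : s < 1 by nra.
have [K KP] := a_dyadic.
have [rho rho1 [K' _ K'P]] := w_lower s0 s1.
have growth j : rho ^+ j * w s K' <= w s (K' + j)%N.
  elim: j => [|j IH]; first by rewrite mul1r addn0.
  rewrite addnS exprS -mulrA; apply: le_trans (K'P (K' + j)%N _) => /=.
    by rewrite ler_pM2l // (lt_trans ltr01).
  exact: leq_addr.
have c0 : 0 < (2 : R) `^ (- theta) by rewrite powR_gt0.
(* Half the limit of t_{2^(k+1)} / t_{2^k}, hence eventually a lower bound for this ratio. *)
pose c : R := 2 `^ (- theta) / 2.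
have c0' : 0 < c by rewrite divr_gt0.
have x0 : 0 < 2 / (c * w s K') by apply: divr_gt0 => //; exact: mulr_gt0.
have rV : `|rho^-1| < 1.
  by rewrite ger0_norm ?invr_ge0 ?invf_lt1 // ?ltW // (lt_trans ltr01).
have [J _ JP] : \forall k \near \oo, c <= t (2 ^ k.+1) / t (2 ^ k).
  near=> k; apply/ltW; near: k; apply: (cvgr_gt _ ratio_cvg).
  by rewrite ltr_pdivrMr // ltr_pMr // ltr1n.
(* From [L] on, rho^j w_{K'} exceeds 2 / c; the 2 makes up for the half of the tail lost by stopping
   at [M]. *)
have [L _ LP] : \forall j \near \oo, rho^-1 ^+ j < (2 / (c * w s K'))^-1.
  by apply: (cvgr_lt _ (cvg_expr rV)); rewrite invr_gt0.
have [k [[Kk mk] ck wk]] : exists k, [/\ (K <= k)%N /\ (m <= 2 ^ k.+1)%N,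
    c * t (2 ^ k) <= t (2 ^ k.+1) & 2 <= c * w s k].
  pose j := (K + m + J + L)%N.
  have [Kj mj Jj Lj] : [/\ (K <= j)%N, (m <= j)%N, (J <= j)%N & (L <= j)%N].
    by rewrite /j; clear; split; lia.
  exists (K' + j)%N; split; first split.
  - exact: leq_trans Kj (leq_addl _ _).
  - apply: (leq_trans mj); apply: leq_trans (ltnW (ltn_expl j (isT : 1 < 2)%N)) _.
    by rewrite leq_exp2l // leqW // leq_addl.
  - by rewrite -ler_pdivlMr //; apply: JP => /=; exact: leq_trans Jj (leq_addl _ _).
  - apply: le_trans (_ : c * (rho ^+ j * w s K') <= _); last by rewrite ler_pM2l.
    rewrite mulrCA -ler_pdivrMr ?(mulr_gt0 c0' (w_gt0 s K')) //.
    have /LP := Lj.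
    rewrite exprVn ltf_pV2 ?posrE ?exprn_gt0 // ?(lt_trans ltr01) //.
    exact: ltW.
have Kn n : (2 ^ k.+1 <= n)%N -> a n * (t (2 ^ k) / 2 ^+ k) `^ (s - 1) <= a n `^ s.
  move=> kn; have n0 : (0 < n)%N by rewrite (leq_trans _ kn) // expn_gt0.
  have an := a_gt0 n0; have ab := KP k n Kk kn.
  set b := t _ / _ in ab *.
  have b0 : 0 < b := lt_le_trans an ab.
  rewrite -(mulr_powRB1_gt0 s an).
  rewrite ler_pM2l // -opprB !powRN lef_pV2 ?posrE ?powR_gt0 //.
  by apply: ge0_ler_powR => //; [rewrite subr_ge0 ltW|rewrite nnegrE ltW|rewrite nnegrE ltW].
(* Stopping at [M] keeps at least half of t_{2^(k+1)} in the telescoped sum. *)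
have [M M0 MP] := t_small (divr_gt0 (t_gt0_pow k.+1) (ltr0n _ 2)).
have kM : (2 ^ k.+1 <= M)%N.
  rewrite leqNgt; apply/negP => Mk.
  have := t_le M0 (ltnW Mk); have := t_gt0_pow k.+1; move: MP; lra.
exists M.
rewrite (big_cat_nat mk kM) /= ler_wpDl //.
  by rewrite sumr_ge0 // => i _; exact: powR_ge0.
apply: le_trans (_ : \sum_(2 ^ k.+1 <= i < M) a i * (t (2 ^ k) / 2 ^+ k) `^ (s - 1) <= _); last first.
  apply: ler_sum_nat => i /andP[ki _]; exact: Kn.
rewrite -mulr_suml sum_a //.
have b0 : 0 < t (2 ^ k) / 2 ^+ k by rewrite divr_gt0 ?exprn_gt0.
move: wk; rewrite /w -(mulr_powRB1_gt0 s b0).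
(* Now [w s k] reads t_{2^k} p with p = b^(s-1), and (t_{2^(k+1)} - t_M) p >= (c / 2) t_{2^k} p >=
   1. *)
rewrite (mulrA (2 ^+ k)) [2 ^+ k * _]mulrC divfK ?expf_neq0 //.
have := powR_gt0 (s - 1) b0; set p := powR _ _ => p0 wk.
nra.
Unshelve. all: by end_near. Qed.

End Growth.

(** Slow variation with y = 2 sends the ratio of the psi factors to 1; the powers of n contribute
    exactly 2^(-theta). *)
Lemma luroth_t_double {R : realType} (A : nat -> set R) (theta : R) :
  expansive A theta ->
  luroth_t A (n * 2)%N / luroth_t A n @[n --> \oo] --> (2 : R) `^ (- theta).
Proof.
move=> [psi [[f [_ f0 fslow psif]] tE]].
have h : f (n%:R * 2) / f n%:R @[n --> \oo] --> (1 : R).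
  exact: (cvg_comp _ _ (@cvgr_idn R) (fslow 2 (ltr0n _ 2))).
rewrite -[X in _ --> X]mul1r.
apply: cvg_trans (cvgM h (cvg_cst ((2 : R) `^ (- theta)))).
apply: near_eq_cvg; near=> n.
have n0 : (0 < n)%N by near: n; exact: nbhs_infty_gt.
have nR : 0 < n%:R :> R by rewrite ltr0n.
rewrite !tE ?muln_gt0 ?n0 // !psif ?muln_gt0 ?n0 // natrM powRM ?ler0n //=.
have : f n%:R != 0 by rewrite gt_eqF // f0.
have : n%:R `^ (- theta) != 0 by rewrite gt_eqF // powR_gt0.
move: (n%:R `^ _) (f n%:R) => u v u0 v0.
by field; rewrite u0 v0.
Unshelve. all: by end_near. Qed.

(** * Diameters and null sets of Hausdorff measures *)

Section Diameter.
Context {R : realType}.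
Implicit Types (U : set R) (s : R).
Local Open Scope ereal_scope.

Lemma diam_ge U x y : U x -> U y -> `|x - y|%:E <= diam U.
Proof. by move=> Ux Uy; apply: ereal_sup_ubound; exists (x, y). Qed.

Lemma diam_le U (d : \bar R) :
  (forall x y, U x -> U y -> `|x - y|%:E <= d) -> diam U <= d.
Proof. by move=> Ud; apply: ge_ereal_sup => _ [[x y] [/= Ux Uy] <-]; exact: Ud. Qed.

Lemma diam_ge0 U : U !=set0 -> 0 <= diam U.
Proof. by move=> [x Ux]; apply: le_trans (diam_ge Ux Ux); rewrite lee_fin. Qed.

(** Empty sets therefore meet every diameter bound and can pad a countable cover. *)
Lemma diam_set0 : diam (@set0 R) = -oo.
Proof.
by rewrite -ereal_sup0 /diam; congr ereal_sup; apply/seteqP; split => // t [[x y] [/= []]].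
Qed.

Lemma diam_pow_ge0 s U : 0 <= diam_pow s U.
Proof. by rewrite /diam_pow; case: ifP => // _; exact: poweR_ge0. Qed.

Lemma diam_powE s U : U !=set0 -> diam_pow s U = diam U `^ s.
Proof. by move=> U0; rewrite /diam_pow ifF //; apply/negbTE/set0P. Qed.

Lemma diam_pow_set0 s : diam_pow s (@set0 R) = 0.
Proof. by rewrite /diam_pow eqxx. Qed.

Lemma ge0_le_poweR s (x y : \bar R) : (0 <= s)%R -> 0 <= x -> x <= y ->
  x `^ s <= y `^ s.
Proof.
move=> s0 x0 xy; have y0 := le_trans x0 xy.
by apply: gt0_ler_poweR; rewrite // in_itv /= ?x0 ?y0 leey.
Qed.

Lemma diam_pow_le s U (d : R) : (0 <= s)%R -> (0 <= d)%R ->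
  (forall x y, U x -> U y -> `|x - y| <= d)%R -> diam_pow s U <= (d `^ s)%:E.
Proof.
move=> s0 d0 Ud; have [->|/set0P U0] := eqVneq U set0.
  by rewrite diam_pow_set0 lee_fin powR_ge0.
rewrite diam_powE // -poweR_EFin; apply: ge0_le_poweR; [|exact: diam_ge0|] => //.
by apply: diam_le => x y Ux Uy; rewrite lee_fin Ud.
Qed.

Lemma diam_affine U (a b : R) : (0 <= a)%R -> U !=set0 ->
  diam [set b - a * x | x in U]%R <= a%:E * diam U.
Proof.
move=> a0 U0; apply: diam_le => _ _ [x Ux <-] [y Uy <-].
have -> : (b - a * x - (b - a * y) = a * (y - x))%R by ring.
by rewrite normrM ger0_norm // EFinM; apply: lee_wpmul2l; [rewrite lee_fin|exact: diam_ge].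
Qed.

Lemma diam_pow_affine s U (a b : R) : (0 <= s)%R -> (0 <= a)%R ->
  diam_pow s [set b - a * x | x in U]%R <= (a `^ s)%:E * diam_pow s U.
Proof.
move=> s0 a0; have [->|/set0P U0] := eqVneq U set0.
  by rewrite image_set0 diam_pow_set0 mule0.
have V0 : [set b - a * x | x in U]%R !=set0 by apply: image_nonempty.
rewrite !diam_powE // -poweR_EFin -poweRM ?lee_fin ?diam_ge0 //.
by apply: ge0_le_poweR; [|exact: diam_ge0|exact: diam_affine].
Qed.

Lemma hausdorff_measure_eq0 s E :
  (forall (e d : R), (0 < e)%R -> (0 < d)%R -> exists U : nat -> set R,
    [/\ E `<=` \bigcup_i U i, forall i, diam (U i) <= d%:E &
        \sum_(i <oo) diam_pow s (U i) <= e%:E]) ->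
  hausdorff_measure s E = 0.
Proof.
move=> H; apply/eqP; rewrite eq_le; apply/andP; split; last first.
  apply: le_ereal_sup_tmp; exists (hausdorff_premeasure s 1 E); first by exists 1%R; rewrite //= ltr01.
  by apply: le_ereal_inf_tmp => _ [U _ <-]; apply: nneseries_ge0 => n _ _; exact: diam_pow_ge0.
apply: ge_ereal_sup => _ [d d0 <-]; apply/lee_addgt0Pr => e e0; rewrite add0e.
have [U [EU Ud Us]] := H e d e0 d0.
by apply: ge_ereal_inf; exists (\sum_(i <oo) diam_pow s (U i)) => //; exists U.
Qed.

(** The lower bound uses only the total s-sum of a cover, so the scale is fixed at 1 and the
    diameter bound is dropped. *)
Lemma hausdorff_measure0_cover s E (e : R) : (0 < e)%R ->
  hausdorff_measure s E = 0 ->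
  exists U : nat -> set R, E `<=` \bigcup_i U i /\
    \sum_(i <oo) diam_pow s (U i) < e%:E.
Proof.
move=> e0 H.
have : hausdorff_premeasure s 1 E < e%:E.
  apply: le_lt_trans (_ : hausdorff_measure s E < _); last by rewrite H lte_fin.
  by apply: ereal_sup_ubound; exists 1%R; rewrite //= ltr01.
by move=> /ereal_inf_lt[_ [U [EU _] <-] Ue]; exists U.
Qed.

End Diameter.

(** * Upper bound: covers by iterated inverse branches *)

Section UpperBound.
Context {R : realType}.
Variable A : nat -> set R.
Hypothesis partA : luroth_partition A.
Local Notation t := (luroth_t A).
Local Notation a := (luroth_a A).

Lemma luroth_a_gt0 n : (0 < n)%N -> 0 < a n.
Proof. by move=> n0; rewrite luroth_aE // subr_gt0 luroth_t_decr. Qed.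

Lemma luroth_digitE n x : (0 < n)%N -> A n x -> luroth_digit A x = n.
Proof.
move=> n0 Anx; rewrite /luroth_digit; apply: xget_unique => // m [m0 Amx].
have [[_ trivA _] _ _] := partA.
by apply: trivA => //; exists x.
Qed.

Lemma luroth_mapE n x : (0 < n)%N -> A n x -> luroth_map A x = (t n - x) / a n.
Proof. by move=> n0 Anx; rewrite /luroth_map (luroth_digitE n0 Anx) gtn_eqF. Qed.

(** Self-similarity of G_N: the witnesses are the first digit of x and its image under [luroth_map],
    whose digits are the shifted sequence. *)
Lemma luroth_G_inverse_branch N x : luroth_G A N x ->
  exists n y, [/\ (N < n)%N, luroth_G A N y & x = t n - a n * y].
Proof.
move=> [x01 [l [lx lN]]].
have [l0 Alx] := lx 0%N; rewrite /= in Alx.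
have a0 := luroth_a_gt0 l0.
have E := luroth_mapE l0 Alx.
exists (l 0%N), (luroth_map A x); split => //; last first.
  by rewrite E mulrC divfK ?gt_eqF // subKr.
split; last first.
  exists (l \o S); split; last by move=> k; exact: lN.
  by move=> k; have := lx k.+1; rewrite iterSr.
move: Alx; rewrite luroth_cell //= in_itv /= => /andP[tx xt].
rewrite /= in_itv /= E divr_ge0 ?subr_ge0 ?(ltW a0) //=.
by rewrite ler_pdivrMr // mul1r luroth_aE // lerD2l lerN2 ltW.
Qed.

(** The new cover consists of the images of all [U i] under all branches n > N. Branch n scales
    diameters by a_n, so the s-sum is multiplied by at most the sum of a_n^s. *)
Let cover_step s N (G : set R) (q c d rho : R) (U : nat -> set R) :
  0 <= s -> 0 <= c -> 0 <= d ->
  (forall x, G x -> exists n y, [/\ (N < n)%N, G y & x = t n - a n * y]) ->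
  (forall n, (N < n)%N -> a n <= rho) ->
  (\sum_(N.+1 <= n <oo) (a n `^ s)%:E <= q%:E)%E ->
  G `<=` \bigcup_i U i -> (forall i, diam (U i) <= d%:E)%E ->
  (\sum_(i <oo) diam_pow s (U i) <= c%:E)%E ->
  exists V : nat -> set R, [/\ G `<=` \bigcup_i V i,
    (forall i, diam (V i) <= (rho * d)%:E)%E &
    (\sum_(i <oo) diam_pow s (V i) <= (q * c)%:E)%E].
Proof.
move=> s0 c0 d0 GP arho asum GU Ud Uc.
have /card_set_bijP[h hbij] : ([set: nat] #= [set: nat * nat])%card.
  by rewrite card_eq_sym; exact: card_nat2.
(* Excluded digits get empty sets, so that the family is indexed by all pairs and can be enumerated
   through [h]. *)
pose V2 n i := if (N < n)%N then [set t n - a n * y | y in U i] else set0.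
have a0 n : (N < n)%N -> 0 <= a n.
  by move=> Nn; rewrite ltW // luroth_a_gt0 // (leq_ltn_trans _ Nn).
exists (fun j => V2 (h j).1 (h j).2); split.
- move=> x /GP[n [y [Nn /GU[i _ Uiy] ->]]].
  have [_ _ /(_ (n, i) I)[j _ hj]] := hbij.
  by exists j => //=; rewrite hj /V2 /= Nn; exists y.
- move=> i /=; rewrite /V2; case: ifPn => [Nn|_]; last by rewrite diam_set0 leNye.
  have [->|/set0P U0] := eqVneq (U (h i).2) set0.
    by rewrite image_set0 diam_set0 leNye.
  apply: le_trans (diam_affine _ (a0 _ Nn) U0) _.
  apply: le_trans (_ : (a (h i).1)%:E * d%:E <= _)%E.
    by apply: lee_wpmul2l; rewrite ?lee_fin ?a0.
  by rewrite -EFinM lee_fin ler_wpM2r // arho.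
(* Unordered sums allow reindexing by pairs and then summing over i inside n. *)
- rewrite nneseries_esumT; last by move=> i; exact: diam_pow_ge0.
  rewrite -(@reindex_esum R _ _ _ _ h (fun p => diam_pow s (V2 p.1 p.2)) hbij).
  have -> : [set: nat * nat] = [set: nat] `*`` (fun=> [set: nat]).
    by apply/seteqP; split.
  rewrite -(@esum_esum R _ _ [set: nat] (fun=> [set: nat]) (fun n i => diam_pow s (V2 n i))); last first.
    by move=> *; exact: diam_pow_ge0.
  rewrite -nneseries_esumT; last by move=> n; apply: esum_ge0 => *; exact: diam_pow_ge0.
  apply: le_trans (_ : (\sum_(n <oo) (c%:E * (if (N < n)%N then (a n `^ s)%:E else 0)) <= _)%E).
    apply: lee_nneseries => n; first by move=> _ _; apply: esum_ge0 => *; exact: diam_pow_ge0.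
    move=> _; rewrite -nneseries_esumT; last by move=> i; exact: diam_pow_ge0.
    rewrite /V2 /=; case: ifPn => Nn; last first.
      by rewrite mule0 eseries0 // => i _ _; rewrite diam_pow_set0.
    apply: le_trans (_ : (\sum_(i <oo) ((a n `^ s)%:E * diam_pow s (U i)) <= _)%E).
      apply: lee_nneseries => i; first by move=> _ _; exact: diam_pow_ge0.
      by move=> _; apply: diam_pow_affine => //; exact: a0.
    rewrite nneseriesZl; last by move=> i _; exact: diam_pow_ge0.
    by rewrite [leRHS]muleC; apply: lee_wpmul2l; rewrite ?lee_fin ?powR_ge0.
  rewrite nneseriesZl; last by move=> i _; case: ifP => // _; rewrite lee_fin powR_ge0.
  rewrite mulrC EFinM; apply: lee_wpmul2l; first by rewrite lee_fin.
  apply: le_trans asum; rewrite (nneseries_split 0 N.+1); last first.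
    by move=> i _; case: ifP => // _; rewrite lee_fin powR_ge0.
  rewrite big1_seq ?add0e ?add0n; last first.
    by move=> i /=; rewrite mem_index_iota /= => iN; rewrite ltnNge -ltnS iN.
  by apply: lee_nneseries => i _; case: ifP => // *; rewrite lee_fin powR_ge0.
Qed.

Lemma hausdorff_dim_luroth_G_le s N (q : R) : 0 <= s -> (0 < N)%N -> q < 1 ->
  (\sum_(N.+1 <= n <oo) (a n `^ s)%:E <= q%:E)%E ->
  (hausdorff_dim (luroth_G A N) <= s%:E)%E.
Proof.
move=> s0 N0 q1 asum.
have q0 : 0 <= q.
  rewrite -lee_fin; apply: le_trans asum.
  by apply: nneseries_ge0 => n _ _; rewrite lee_fin powR_ge0.
have t2 : t 2 < 1 by rewrite -(luroth_t1 partA) luroth_t_decr.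
have t20 : 0 <= t 2 by rewrite ltW // luroth_t_gt0.
(* As N >= 1, digit 1 never occurs, and t_2 < 1 is a contraction rate common to all branches. *)
have at2 n : (N < n)%N -> a n <= t 2.
  move=> Nn; have n0 : (0 < n)%N by rewrite (leq_ltn_trans _ Nn).
  rewrite luroth_aE //; apply: le_trans (_ : t n <= _).
    by rewrite gerBl ltW // luroth_t_gt0.
  apply: (t_le (luroth_t_decr partA)) => //; lia.
have covers k : exists U : nat -> set R, [/\ luroth_G A N `<=` \bigcup_i U i,
    (forall i, diam (U i) <= (t 2 ^+ k)%:E)%E &
    (\sum_(i <oo) diam_pow s (U i) <= (q ^+ k)%:E)%E].
  elim: k => [|k [U [GU Ud Uc]]]; last first.
    rewrite !exprS; apply: (cover_step s0 _ _ (@luroth_G_inverse_branch N) at2 asum GU Ud Uc).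
      exact: exprn_ge0.
    exact: exprn_ge0.
  (* Level 0: the unit interval alone, padded with empty sets. *)
  exists (fun i => if i == 0%N then `[0, 1]%classic else set0); split.
  - by move=> x [x01 _]; exists 0%N.
  - move=> i; case: eqP => _; last by rewrite diam_set0 leNye.
    apply: diam_le => x y /=; rewrite !in_itv /= expr0 lee_fin => /andP[x0 x1] /andP[y0 y1].
    by rewrite ler_norml; apply/andP; split; lra.
  - rewrite expr0 nneseries_recl //; last by move=> i _; exact: diam_pow_ge0.
    rewrite /= eseries0 ?adde0; last first.
      by move=> [//|i] _ _ /=; exact: diam_pow_set0.
    apply: le_trans (diam_pow_le s0 (@ler01 R) _) _; last by rewrite powR1.
    move=> x y /=; rewrite !in_itv /= => /andP[x0 x1] /andP[y0 y1].
    by rewrite ler_norml; apply/andP; split; lra.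
apply: ereal_inf_lbound; exists s => //; split => //.
apply: hausdorff_measure_eq0 => e d e0 d0.
have small (z : R) (r : R) : 0 < r -> 0 <= z < 1 -> \forall k \near \oo, z ^+ k <= r.
  move=> r0 /andP[z0 z1]; have z1' : `|z| < 1 by rewrite ger0_norm.
  near=> k; apply/ltW; near: k; exact: (cvgr_lt _ (cvg_expr z1')).
near \oo => k.
have [U [GU Ud Uc]] := covers k.
exists U; split => //.
- move=> i; apply: le_trans (Ud i) _; rewrite lee_fin.
  by near: k; apply: small; rewrite // t20.
- apply: le_trans Uc _; rewrite lee_fin.
  by near: k; apply: small; rewrite // q0.
Unshelve. all: by end_near. Qed.

End UpperBound.

(** * Digit sequences avoiding a family of words of small total weight *)

Section Kraft.
Context {R : realType}.
Variables (b : nat -> R) (D : seq nat).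
Hypothesis D_uniq : uniq D.
Hypothesis b_ge0 : forall n, 0 <= b n.
Hypothesis b_sum : 1 <= \sum_(n <- D) b n.

Definition word_weight (w : seq nat) : R := \prod_(n <- w) b n.

Lemma word_weight_ge0 w : 0 <= word_weight w.
Proof. by apply: prodr_ge0 => n _; exact: b_ge0. Qed.

Lemma word_weight_rcons w n : word_weight (rcons w n) = word_weight w * b n.
Proof. by rewrite /word_weight -cats1 big_cat big_seq1. Qed.

(* Converse to Kraft's inequality: descend greedily, keeping the total weight
   of the words that extend the current prefix below the weight of the prefix. *)
Lemma kraft_avoid (W : nat -> option (seq nat)) :
  (\sum_(i <oo) (oapp word_weight 0 (W i))%:E < 1%:E)%E ->
  exists l : nat -> nat, (forall k, l k \in D) /\
    forall i k, W i <> Some (mkseq l k).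
Proof.
move=> W1.
(* [f u] will be the total weight of the listed words extending [u]; a prefix is good when this
   stays below the weight of [u]. *)
pose F u i := if W i is Some w then if prefix u w then word_weight w else 0 else 0.
have F0 u i : (0 <= (F u i)%:E)%E.
  by rewrite lee_fin /F; case: (W i) => [w|//]; case: ifP => // _; exact: word_weight_ge0.
pose f u := (\sum_(i <oo) (F u i)%:E)%E.
pose good u := (f u < (word_weight u)%:E)%E.
have good0 : good [::].
  rewrite /good /word_weight big_nil; apply: le_lt_trans W1.
  apply: lee_nneseries => i //; rewrite lee_fin /F.
  by case: (W i) => [w|//]; rewrite prefix0s.
have step u : good u -> exists2 n, n \in D & good (rcons u n).
  move=> gu; apply: contrapT => H.
  have {}H n : n \in D -> ((word_weight u)%:E * (b n)%:E <= f (rcons u n))%E.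
    move=> nD; rewrite leNgt; apply/negP => h; apply: H; exists n => //.
    by rewrite /good word_weight_rcons EFinM.
  have : (\sum_(n <- D) f (rcons u n) <= f u)%E.
    rewrite -nneseries_sum; last by move=> *; exact: F0.
    apply: lee_nneseries => i; first by move=> *; apply: sume_ge0 => *; exact: F0.
    move=> _; rewrite sumEFin lee_fin /F; case: (W i) => [w|]; last by rewrite big1.
    have sub n : prefix (rcons u n) w -> prefix u w.
      exact: prefix_trans (prefix_rcons _ _).
    have [/prefixP[v wE]|uw] := boolP (prefix u w); last first.
      by rewrite big1 // => n _; case: ifP => // /sub; rewrite (negbTE uw).
    (* The word [u] itself extends no child of [u], while a longer word extends only the child given
       by its next letter; as [D] has no repetitions it is counted at most once. *)
    case: v wE => [|x v] wE.
      rewrite big1 ?word_weight_ge0 // => n _; case: ifP => // /prefixP[v].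
      by move=> /(congr1 size); rewrite wE !size_cat size_rcons /=; lia.
    have E n : prefix (rcons u n) w = (n == x).
      by rewrite wE -cats1 prefix_catr // eqxx /= prefix0s andbT.
    under eq_bigr do rewrite E.
    rewrite -big_mkcond /= big_const_seq (count_uniq_mem x D_uniq) iter_addr_0.
    by case: (x \in D); rewrite ?mulr1n ?mulr0n ?word_weight_ge0.
  apply/negP; rewrite -ltNge; apply: (lt_le_trans gu).
  apply: le_trans (_ : \sum_(n <- D) ((word_weight u)%:E * (b n)%:E) <= _)%E.
    under eq_bigr do rewrite -EFinM.
    rewrite sumEFin lee_fin -mulr_sumr ler_peMr //; exact: word_weight_ge0.
  by rewrite big_seq [leRHS]big_seq; apply: lee_sum => n; exact: H.
pose g u := xget 0%N [set n | n \in D /\ good (rcons u n)].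
have gP u : good u -> g u \in D /\ good (rcons u (g u)).
  by move=> /step[n nD gn]; apply: (@xgetPex _ 0%N [set n | n \in D /\ good (rcons u n)]); exists n.
pose u k := iter k (fun w => rcons w (g w)) [::].
have gu k : good (u k) by elim: k => [//|k IH]; exact: (gP _ IH).2.
exists (fun k => g (u k)); split; first by move=> k; exact: (gP _ (gu k)).1.
have uE k : mkseq (fun k => g (u k)) k = u k.
  by elim: k => [//|k IH]; rewrite mkseqS IH.
move=> i k; rewrite uE => Wi.
have := gu k; rewrite /good ltNge => /negP; apply.
(* If [W i] were the prefix [u k], its own weight would already make [f (u k)] too large for a good
   prefix. *)
apply: le_trans (_ : (F (u k) i)%:E <= _)%E; first by rewrite /F Wi prefix_refl.
rewrite /f (@nneseriesD1 R _ i xpredT) //.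
by rewrite leeDl // nneseries_ge0 // => *; exact: F0.
Qed.

End Kraft.

(** * Lower bound: points with prescribed digits *)

Section LowerBound.
Context {R : realType}.
Variable A : nat -> set R.
Hypothesis partA : luroth_partition A.
Local Notation t := (luroth_t A).
Local Notation a := (luroth_a A).

Definition cylinder_length (l : nat -> nat) k : R := \prod_(i < k) a (l i).

(** The terms, counted from 0, of the alternating series that recovers a point from its digits. *)
Definition luroth_terms (l : nat -> nat) k : R :=
  (-1) ^+ k * cylinder_length l k * t (l k).

Definition luroth_point (l : nat -> nat) : R := limn (series (luroth_terms l)).

Let t_ge0 n : (0 < n)%N -> 0 <= t n.
Proof. by move=> n0; rewrite ltW // luroth_t_gt0. Qed.

Let t_le1 n : (0 < n)%N -> t n <= 1.
Proof. by move=> n0; rewrite -(luroth_t1 partA) t_le // => k; exact: luroth_t_decr. Qed.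

Let t2_lt1 : t 2 < 1.
Proof. by rewrite -(luroth_t1 partA) luroth_t_decr. Qed.

Let t_le2 n : (1 < n)%N -> t n <= t 2.
Proof. by move=> n1; rewrite t_le // => k; exact: luroth_t_decr. Qed.

Let a_le n : (0 < n)%N -> a n <= t n.
Proof. by move=> n0; rewrite luroth_aE // gerBl t_ge0. Qed.

Let a_ge0 n : (0 < n)%N -> 0 <= a n.
Proof. by move=> n0; rewrite ltW // luroth_a_gt0. Qed.

Let cylinder_lengthS l k :
  cylinder_length l k.+1 = a (l 0%N) * cylinder_length (l \o S) k.
Proof. by rewrite /cylinder_length big_ord_recl. Qed.

Section Point.
Variable l : nat -> nat.
Hypothesis l_gt1 : forall k, (1 < l k)%N.

Let l_gt0 k : (0 < l k)%N. Proof. exact: ltnW. Qed.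

Lemma cylinder_length_ge0 k : 0 <= cylinder_length l k.
Proof. by apply: prodr_ge0 => i _; exact: a_ge0. Qed.

Lemma cylinder_length_le k : cylinder_length l k <= t 2 ^+ k.
Proof.
rewrite -[k in leRHS]card_ord -prodr_const; apply: ler_prod => i _.
by rewrite a_ge0 //= (le_trans (a_le _)) // t_le2.
Qed.

(** Digits above 1 make the geometric series of ratio t_2 < 1 a majorant. *)
Lemma luroth_point_cvg : cvgn (series (luroth_terms l)).
Proof.
apply: normed_cvg.
have t2 : `|t 2| < 1 by rewrite ger0_norm ?t_ge0.
apply: series_le_cvg (@is_cvg_geometric_series R 1 _ t2) => [n|n|n]; rewrite /geometric /=.
- exact: normr_ge0.
- by rewrite mul1r exprn_ge0 // t_ge0.
- rewrite mul1r /luroth_terms !normrM normrX normrN1 expr1n mul1r.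
  rewrite !ger0_norm ?t_ge0 ?cylinder_length_ge0 //.
  rewrite -[leRHS]mulr1; apply: ler_pM => //; rewrite ?t_ge0 ?cylinder_length_ge0 //.
  + exact: cylinder_length_le.
  + exact: t_le1.
Qed.

End Point.

Let series_luroth_termsS l n : series (luroth_terms l) n.+1 =
  t (l 0%N) - a (l 0%N) * series (luroth_terms (l \o S)) n.
Proof.
rewrite /series /= big_nat_recl // /luroth_terms /cylinder_length big_ord0.
rewrite expr0 !mul1r mulr_sumr -sumrN; congr (_ + _); apply: eq_bigr => k _.
by rewrite big_ord_recl exprS /=; ring.
Qed.

Lemma luroth_pointE l : (forall k, 1 < l k)%N ->
  luroth_point l = t (l 0%N) - a (l 0%N) * luroth_point (l \o S).
Proof.
move=> l1; apply/cvg_lim => //; rewrite -(cvg_shiftn 1) /=.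
have : series (luroth_terms (l \o S)) n @[n --> \oo] --> luroth_point (l \o S).
  by apply: luroth_point_cvg => k; exact: l1.
move=> h.
have -> : (fun n => series (luroth_terms l) (n + 1)%N) =
    (fun n => t (l 0%N) - a (l 0%N) * series (luroth_terms (l \o S)) n).
  by apply/funext => n; rewrite addn1 series_luroth_termsS.
by apply: cvgB; [exact: cvg_cst|apply: cvgM => //; exact: cvg_cst].
Qed.

Let series_bounds n l : (forall k, 1 < l k)%N ->
  0 <= series (luroth_terms l) n <= t (l 0%N).
Proof.
elim: n l => [|n IH] l l1.
  by rewrite /series /= big_geq // lexx t_ge0 // ltnW.
have l0 : (0 < l 0)%N by exact: ltnW.
have /andP[s0 s1] : 0 <= series (luroth_terms (l \o S)) n <= t (l 1%N).
  by apply: IH => k; exact: l1.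
rewrite series_luroth_termsS gerBl mulr_ge0 ?a_ge0 // andbT subr_ge0.
apply: le_trans (a_le l0); rewrite ler_piMr ?a_ge0 //.
by rewrite (le_trans s1) // t_le1 // ltnW.
Qed.

Lemma luroth_point_ge0 l : (forall k, 1 < l k)%N -> 0 <= luroth_point l.
Proof.
move=> l1; apply: limr_ge; first exact: luroth_point_cvg.
by apply: nearW => n; have /andP[] := series_bounds n l1.
Qed.

Lemma luroth_point_le l : (forall k, 1 < l k)%N -> luroth_point l <= t (l 0%N).
Proof.
move=> l1; apply: limr_le; first exact: luroth_point_cvg.
by apply: nearW => n; have /andP[] := series_bounds n l1.
Qed.

(** The open left end is avoided because the shifted point is at most t_2 < 1, so less than the full
    length a_{l_0} is subtracted from t_{l_0}. *)
Lemma luroth_point_cell l : (forall k, 1 < l k)%N -> A (l 0%N) (luroth_point l).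
Proof.
move=> l1; have l0 : (0 < l 0)%N by exact: ltnW.
have l1' : (forall k, 1 < (l \o S) k)%N by move=> k; exact: l1.
rewrite luroth_cell //= in_itv /= luroth_point_le // andbT.
rewrite luroth_pointE //.
have -> : t (l 0%N).+1 = t (l 0%N) - a (l 0%N) by rewrite luroth_aE // subKr.
rewrite ltrD2l ltrN2 gtr_pMr ?luroth_a_gt0 //.
apply: le_lt_trans (luroth_point_le l1') _ => /=.
by apply: le_lt_trans t2_lt1; exact: t_le2.
Qed.

Lemma luroth_map_point l : (forall k, 1 < l k)%N ->
  luroth_map A (luroth_point l) = luroth_point (l \o S).
Proof.
move=> l1; have l0 : (0 < l 0)%N by exact: ltnW.
rewrite (luroth_mapE partA l0 (luroth_point_cell l1)) (luroth_pointE l1) subKr.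
by rewrite mulrC mulKf // gt_eqF // luroth_a_gt0.
Qed.

Lemma luroth_point_G l N : (forall k, 1 < l k)%N -> (forall k, N < l k)%N ->
  luroth_G A N (luroth_point l).
Proof.
move=> l1 lN; split.
  rewrite /= in_itv /= luroth_point_ge0 //= (le_trans (luroth_point_le l1)) //.
  by rewrite t_le1 // ltnW.
exists l; split=> // k; split; first exact: ltnW.
have -> : iter k (luroth_map A) (luroth_point l) = luroth_point (fun i => l (k + i)%N).
  elim: k => [//|k IH]; rewrite iterS IH luroth_map_point //.
  by congr luroth_point; apply/funext => i /=; rewrite addnS.
by have := @luroth_point_cell (fun i => l (k + i)%N); rewrite addn0; exact.
Qed.

(** * Distances between points with different digits *)

Section Separation.
Variables (m M : nat) (c : R).
Hypothesis m1 : (1 < m)%N.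
Hypothesis c0 : 0 < c.
Hypothesis a_ge : forall n, (m <= n < M)%N -> c <= a n.
Let digits (l : nat -> nat) := forall k, (m <= l k < M)%N.
Let gap := c * (1 - t m).

Let digits_gt1 l : digits l -> forall k, (1 < l k)%N.
Proof. by move=> lD k; have /andP[mk _] := lD k; exact: leq_trans mk. Qed.

Let tm_lt1 : t m < 1.
Proof. by apply: le_lt_trans t2_lt1; exact: t_le2. Qed.

Let gap_gt0 : 0 < gap.
Proof. by rewrite mulr_gt0 // subr_gt0. Qed.

Let tail_le l : digits l -> luroth_point (l \o S) <= t m.
Proof.
move=> lD; have l1 := digits_gt1 lD.
apply: le_trans (luroth_point_le _) _; first by move=> k; exact: l1.
rewrite /= t_le //; first by move=> k; exact: luroth_t_decr.
  exact: ltnW.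
by have /andP[] := lD 1%N.
Qed.

(** The point of [l'] lies at or below the left end of the cell of [l 0]. That of [l] stays
    a_{l_0}(1 - y) above this end, where its shifted point y is at most t_m. *)
Let first_digit_gap l l' : digits l -> digits l' -> (l 0 < l' 0)%N ->
  gap <= luroth_point l - luroth_point l'.
Proof.
move=> lD lD' ll'; have l1 := digits_gt1 lD; have l1' := digits_gt1 lD'.
have l0 : (0 < l 0)%N by exact: ltnW.
have h1 : luroth_point l' <= t (l 0%N).+1.
  apply: le_trans (luroth_point_le l1') _; apply: t_le => // k; exact: luroth_t_decr.
have h2 := luroth_pointE l1.
have h3 := tail_le lD.
have h4 := a_ge (lD 0%N).
have h5 := luroth_aE partA l0.
have h6 : c * (1 - t m) <= a (l 0%N) * (1 - luroth_point (l \o S)).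
  by apply: ler_pM; rewrite ?(ltW c0) ?subr_ge0 ?(ltW tm_lt1) // lerD2l lerN2.
rewrite /gap h2; lra.
Qed.

(** Each common digit n scales the difference by -a_n, which reduces the claim to
    [first_digit_gap]. *)
Lemma luroth_point_separation k l l' : digits l -> digits l' ->
  (forall i, (i < k)%N -> l i = l' i) -> l k <> l' k ->
  cylinder_length l k * gap <= `|luroth_point l - luroth_point l'|.
Proof.
elim: k l l' => [|k IH] l l' lD lD' ll' /eqP lk.
  rewrite /cylinder_length big_ord0 mul1r.
  move: lk; rewrite neq_ltn => /orP[] lk.
    by apply: le_trans (first_digit_gap lD lD' lk) _; exact: ler_norm.
  by rewrite distrC; apply: le_trans (first_digit_gap lD' lD lk) _; exact: ler_norm.
have l0 : (0 < l 0)%N by apply: ltnW; exact: digits_gt1.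
rewrite cylinder_lengthS (luroth_pointE (digits_gt1 lD)) (luroth_pointE (digits_gt1 lD')).
rewrite -(ll' 0%N) // -mulrA.
have -> x y z w : x - y * z - (x - y * w) = y * (w - z) :> R by ring.
rewrite normrM ger0_norm ?a_ge0 // ler_wpM2l ?a_ge0 // distrC.
apply: IH.
- by move=> i; exact: lD.
- by move=> i; exact: lD'.
- by move=> i ik; exact: ll'.
- exact/eqP.
Qed.

Hypothesis c1 : c <= 1.

(* The word is the longest common prefix of the digit sequences of the points
   of U, cut short if these points all coincide. *)
Lemma luroth_point_capture (s e : R) (U : set R) l : 0 <= s -> 0 < e ->
  digits l -> U (luroth_point l) ->
  exists k, (forall l', digits l' -> U (luroth_point l') ->
      forall i, (i < k)%N -> l i = l' i) /\
    (((gap * cylinder_length l k) `^ s)%:E <= diam_pow s U + e%:E)%E.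
Proof.
move=> s0 e0 lD Ul.
have U0 : U !=set0 by exists (luroth_point l).
have e0' : (0%R <= e%:E)%E by rewrite lee_fin ltW.
(* The least such position is the length of the longest common prefix. *)
pose split k := `[< exists l', [/\ digits l', U (luroth_point l') & l k <> l' k] >].
have gap1 : gap <= 1.
  rewrite /gap -[leRHS]mulr1 ler_pM ?(ltW c0) ?subr_ge0 ?(ltW tm_lt1) //.
  by rewrite gerBl t_ge0 // ltnW.
have [ex|nex] := pselect (exists k, split k).
  have [/= k /asboolP[l' [lD' Ul' lk]] kmin] := ex_minnP ex.
  have agree l'' : digits l'' -> U (luroth_point l'') -> forall i, (i < k)%N -> l i = l'' i.
    move=> lD'' Ul'' i ik; apply: contrapT => li; move: ik; rewrite ltnNge => /negP; apply.
    by apply: kmin; apply/asboolP; exists l''.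
  exists k; split=> //.
  apply: le_trans (leeDl _ e0'); rewrite diam_powE // -poweR_EFin; apply: ge0_le_poweR => //.
    by rewrite lee_fin mulr_ge0 ?(ltW gap_gt0) // cylinder_length_ge0 //; exact: digits_gt1.
  apply: le_trans (diam_ge Ul Ul'); rewrite lee_fin mulrC.
  exact: luroth_point_separation (agree _ lD' Ul') lk.
have agree l' : digits l' -> U (luroth_point l') -> forall i, l i = l' i.
  by move=> lD' Ul' i; apply: contrapT => li; apply: nex; exists i; apply/asboolP; exists l'.
(* For s = 0 long words do not become light; the empty word works, as both powers equal 1. *)
have [->|sN0] := eqVneq s 0.
  exists 0%N; split=> //.
  rewrite powRr0; apply: le_trans (leeDl _ e0'); rewrite diam_powE // poweRe0 //.
have t2 : `|t 2| < 1 by rewrite ger0_norm ?t_ge0.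
near \oo => k; exists k; split; first by move=> l' lD' Ul' i _; exact: agree.
apply: le_trans (leeDr _ (diam_pow_ge0 _ _)); rewrite lee_fin.
(* It suffices that the cylinder is shorter than e^(1/s), which holds for k large. *)
have es : e = (e `^ s^-1) `^ s by rewrite -powRrM mulVf // powRr1 // ltW.
rewrite es; apply: ge0_ler_powR => //.
- by rewrite nnegrE mulr_ge0 ?(ltW gap_gt0) // cylinder_length_ge0 //; exact: digits_gt1.
- by rewrite nnegrE powR_ge0.
apply: le_trans (_ : t 2 ^+ k <= _).
  rewrite -[leRHS]mul1r ler_pM ?(ltW gap_gt0) ?cylinder_length_ge0 //; first exact: digits_gt1.
  by apply: cylinder_length_le; exact: digits_gt1.
apply/ltW; near: k; apply: (cvgr_lt _ (cvg_expr t2)).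
exact: powR_gt0.
Unshelve. all: by end_near. Qed.

End Separation.

End LowerBound.

(** In a null set, cheap covers exist; capturing each covering set by a word gives total weight
    below 1, and [kraft_avoid] then produces an uncovered point of G_N. *)
Lemma luroth_G_measure_neq0 {R : realType} (A : nat -> set R) (s : R) (N m M : nat) :
  luroth_partition A -> 0 <= s -> (1 < m)%N -> (N < m)%N ->
  1 <= \sum_(m <= n < M) luroth_a A n `^ s ->
  hausdorff_measure s (luroth_G A N) <> 0%E.
Proof.
move=> partA s0 m1 Nm sum1 H0.
have a0 n : (0 < n)%N -> 0 < luroth_a A n by exact: luroth_a_gt0.
have digit_gt0 (l : nat -> nat) : (forall i, m <= l i < M)%N -> forall i, (0 < l i)%N.
  by move=> lD i; have /andP[mi _] := lD i; rewrite (leq_trans _ mi) // ltnW.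
(* Finiteness of the alphabet enters here: [c] is the minimum of 1 and the a_n with m <= n < M. *)
have [c [c0 c1 a_ge]] : exists c : R,
    [/\ 0 < c, c <= 1 & forall n, (m <= n < M)%N -> c <= luroth_a A n].
  elim: {sum1 digit_gt0} M => [|M' [c [c0 c1 cP]]]; first by exists 1; split => // n; lia.
  have [M0|M0] := posnP M'; first by exists c; split => // n; lia.
  exists (Num.min c (luroth_a A M')); split.
  - by rewrite lt_min c0 a0.
  - by rewrite ge_min c1.
  - move=> n /andP[mn]; rewrite ltnS leq_eqVlt => /orP[/eqP ->|nM].
      by rewrite ge_min lexx orbT.
    by rewrite ge_min cP ?mn.
set b := fun n => luroth_a A n `^ s.
have weightE l k : (forall i, (m <= l i < M)%N) ->
    word_weight b (mkseq l k) = cylinder_length A l k `^ s.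
  move=> lD; elim: k => [|k IH].
    by rewrite /word_weight /cylinder_length big_nil big_ord0 powR1.
  rewrite mkseqS word_weight_rcons IH /cylinder_length big_ord_recr /= powRM //.
    apply: prodr_ge0 => i _; exact: (ltW (a0 _ (digit_gt0 _ lD _))).
  exact: (ltW (a0 _ (digit_gt0 _ lD _))).
have tm1 : luroth_t A m < 1.
  rewrite -(luroth_t1 partA); apply: le_lt_trans (luroth_t_decr partA (isT : 0 < 1)%N).
  by apply: t_le => // k; exact: luroth_t_decr.
pose gap := c * (1 - luroth_t A m).
have gap0 : 0 < gap by rewrite mulr_gt0 // subr_gt0.
(* One [e] bounds the s-sum of the cover, the other is spread over the sets as e / 2^(i+1); together
   they stay below gap^s. *)
pose e := gap `^ s / 2.
have e0 : 0 < e by rewrite divr_gt0 // powR_gt0.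
have [U [GU Ue]] := hausdorff_measure0_cover e0 H0.
(* [None] is for sets containing no point with digits in the alphabet. *)
have word i : exists w : option (seq nat),
    (forall l, (forall k, (m <= l k < M)%N) -> U i (luroth_point A l) ->
      exists k, w = Some (mkseq l k)) /\
    ((gap `^ s * oapp (word_weight b) 0 w)%:E <=
      diam_pow s (U i) + (e / (2 ^ i.+1)%:R)%:E)%E.
  have ei : 0 < e / (2 ^ i.+1)%:R by rewrite divr_gt0 // ltr0n expn_gt0.
  have [[l [lD Ul]]|nl] := pselect (exists l, (forall k, (m <= l k < M)%N) /\ U i (luroth_point A l)).
    have [k [agree kP]] := luroth_point_capture partA m1 c0 a_ge c1 s0 ei lD Ul.
    exists (Some (mkseq l k)); split.
      move=> l' lD' Ul'; exists k; congr Some; apply/eq_in_map => j.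
      by rewrite mem_iota /= => jk; apply: agree.
    rewrite /= weightE // -powRM ?(ltW gap0) //.
    apply: prodr_ge0 => j _; exact: (ltW (a0 _ (digit_gt0 _ lD _))).
  exists None; split; first by move=> l lD Ul; exfalso; apply: nl; exists l.
  by rewrite /= mulr0 adde_ge0 ?diam_pow_ge0 // lee_fin ltW.
have [W WP] := choice word.
have W1 : (\sum_(i <oo) (oapp (word_weight b) 0 (W i))%:E < 1%:E)%E.
  have b_ge0 : forall n, 0 <= b n by move=> n; exact: powR_ge0.
  have W0 i : (0%R <= (oapp (word_weight b) 0 (W i))%:E)%E.
    by rewrite lee_fin; case: (W i) => //= w; exact: word_weight_ge0.
  have g0 : (0 < (gap `^ s)%:E)%E by rewrite lte_fin powR_gt0.
  rewrite -(@lte_pmul2l _ (gap `^ s)%:E) // mule1 -nneseriesZl //.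
  have gE : (gap `^ s)%:E = (e%:E + e%:E)%E by rewrite -EFinD -splitr.
  rewrite [ltRHS]gE.
  apply: (@le_lt_trans _ _ (\sum_(i <oo) diam_pow s (U i) + e%:E)%E); last first.
    by rewrite lteD2rE.
  have := epsilon_trick xpredT (fun i => diam_pow_ge0 s (U i)) (ltW e0).
  apply: le_trans.
  apply: lee_nneseries => i; first by move=> _ _; rewrite mule_ge0 // ltW.
  by move=> _; rewrite -EFinM; exact: (WP i).2.
have [l [lD lW]] := kraft_avoid (iota_uniq m (M - m)) (fun n => powR_ge0 _ s) sum1 W1.
have lD' k : (m <= l k < M)%N by have := lD k; rewrite mem_index_iota.
have : luroth_G A N (luroth_point A l).
  by apply: luroth_point_G => // k; have /andP[+ _] := lD' k; lia.
move=> /GU[i _ Ui].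
have [k Wi] := (WP i).1 l lD' Ui.
exact: (lW i k).
Qed.

(** * The limit of the dimensions *)

Theorem theorem1 (R : realType) (A : nat -> set R) (theta : R) :
  luroth_partition A -> 0 <= theta -> expansive A theta ->
  eventually_decreasing A ->
  hausdorff_dim (luroth_G A N) @[N --> \oo] --> (1 / (1 + theta))%:E.
Proof.
move=> partA th0 expA decA.
have th1 : 0 < 1 + theta by rewrite ltr_wpDr.
pose t := luroth_t A.
have aE n : (0 < n)%N -> luroth_a A n = t n - t n.+1 by exact: luroth_aE.
have decT : \forall n \near \oo, t n - t n.+1 < t n.-1 - t n.-1.+1.
  (* At n = 1 the predecessor would be index 0, where [aE] says nothing. *)
  near=> n; have n1 : (1 < n)%N by near: n; exact: nbhs_infty_gt.
  rewrite -!aE; [|lia|lia].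
  by near: n.
have tdbl : t (n * 2)%N / t n @[n --> \oo] --> (2 : R) `^ (- theta).
  exact: luroth_t_double expA.
have t_gt0 : forall n, (0 < n)%N -> 0 < t n by exact: luroth_t_gt0.
have t_decr : forall n, (0 < n)%N -> t n.+1 < t n by exact: luroth_t_decr.
have lower N : ((1 / (1 + theta))%:E <= hausdorff_dim (luroth_G A N))%E.
  apply: le_ereal_inf_tmp => _ [s [s0 Hs] <-]; rewrite lee_fin leNgt.
  rewrite ltr_pdivlMr // ; apply/negP => s1.
  (* The smallest digit must exceed N, and also 1 for the coding series to converge
     geometrically. *)
  have m0 : (0 < maxn 2 N.+1)%N by lia.
  have [M MP] := sum_powR_large t_gt0 t_decr (luroth_t_small partA) tdbl decT s0 th0 s1 m0.
  apply: (luroth_G_measure_neq0 (M := M) partA s0 _ _ _ Hs) => [||]; last first.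
  - apply: le_trans MP _; apply: ler_sum_nat => i ?; rewrite aE //; lia.
  - lia.
  - lia.
have upper (e : R) : 0 < e -> \forall N \near \oo,
    (hausdorff_dim (luroth_G A N) <= (1 / (1 + theta) + e)%:E)%E.
  move=> e0; set s := _ + e.
  have s0 : 0 <= s by rewrite addr_ge0 ?divr_ge0 ?ltW.
  have s1 : 1 < s * (1 + theta).
    by rewrite mulrDl divfK ?gt_eqF // ltrDl mulr_gt0.
  have tail := sum_powR_tail_cvg0 t_gt0 t_decr tdbl decT s0 s1.
  have [K _ KP] : \forall N \near \oo,
      (\sum_(N <= n <oo) ((t n - t n.+1) `^ s)%:E <= (2^-1 : R)%:E)%E.
    have [tfin tcvg] := (fine_cvgP _ _).1 tail.
    near=> N; rewrite -[leLHS]fineK; last by near: N.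
    rewrite lee_fin ltW //; near: N; apply: (cvgr_lt _ tcvg).
    by rewrite invr_gt0.
  near=> N; have N0 : (0 < N)%N by near: N; exact: nbhs_infty_gt.
  apply: (hausdorff_dim_luroth_G_le partA (q := 2^-1)) => //; first by rewrite invf_lt1 // ltr1n.
  have KN : (K <= N.+1)%N by apply: leqW; near: N; exact: nbhs_infty_ge.
  apply: le_trans (KP _ KN).
  rewrite -(@nneseries_addn _ (fun n => (luroth_a A n `^ s)%:E)); last first.
    by move=> i; rewrite lee_fin powR_ge0.
  rewrite -(@nneseries_addn _ (fun n => ((t n - t n.+1) `^ s)%:E)); last first.
    by move=> i; rewrite lee_fin powR_ge0.
  apply: lee_nneseries => i; first by rewrite lee_fin powR_ge0.
  by rewrite aE // addnS.
(* Convergence in the extended reals requires eventual finiteness, obtained from [lower] and from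
   [upper] with e = 1. *)
apply/fine_cvgP; split.
  near=> N.
  rewrite fin_numE; apply/andP; split.
    by rewrite gt_eqF // (lt_le_trans _ (lower N)) // ltNyr.
  rewrite lt_eqF // (le_lt_trans (_ : _ <= (1 / (1 + theta) + 1)%:E)%E) ?ltry //.
  by near: N; exact: upper.
apply/cvgrPdist_le => e e0; near=> N.
have := lower N; have : (hausdorff_dim (luroth_G A N) <= (1 / (1 + theta) + e)%:E)%E.
  by near: N; exact: upper.
rewrite /=; case: (hausdorff_dim _) => [d| |] //=; rewrite ?lee_fin => h1 h2.
by rewrite ler_distlC; apply/andP; split; lra.
Unshelve. all: by end_near. Qed.
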